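(* Let $0<\beta<1/6$ and $0<\kappa<1$, and let $N$ be a positive integer. Let $A_1,A_2\subset[1,N]$ be sets of integers with $|A_i|\ge4\beta N$ for $i=1,2$. Suppose that $A_1$ is $(\beta,\kappa)$-regular. Then for every real $\gamma$ with $0<\gamma<\min\bigl(\kappa^2/(16\beta^2),\beta^2/16\bigr)$, $$|D_{\gamma N}(A_1,A_2)|\ge\min(N,|A_1|+|A_2|)+|A_2|-9\beta N.$$
   Context: For real $y\ge2$, $P(y)$ is the product of all primes $p\le y$. For $0<\beta,\kappa<1$, a set of integers $A\subset[1,N]$ is $(\beta,\kappa)$-regular if $$|\{(u,v)\in A\times A: u\le\beta N,\ v\ge(1-\beta)N,\ \gcd(v-u,P(\beta^{-1}))=1\}|\ge\kappa N^2.$$ For finite $A_1,A_2\subset\mathbb{Z}$ and real $K>0$, $D_K(A_1,A_2)=\{s\in A_1+A_2: r(s)\ge K\}$, where $r(s)$ is the number of pairs $(a_1,a_2)\in A_1\times A_2$ with $a_1+a_2=s$. *)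

(* Defs.v *)
From HB Require Import structures.
From mathcomp Require Import all_boot all_order all_algebra finmap reals.

Set Implicit Arguments.
Unset Strict Implicit.
Unset Printing Implicit Defensive.

Import Order.TTheory GRing.Theory Num.Theory.

Local Open Scope fset_scope.
Local Open Scope ring_scope.

(* For y >= 0 the index bound keeps every prime p <= y, since p <= y amounts to
   p <= Num.truncn y. *)
Definition primorial (R : realType) (y : R) : nat :=
  (\prod_(0 <= p < (Num.truncn y).+1 | prime p && (p%:R <= y)%R) p)%N.

Definition within_1N (N : nat) (A : {fset int}) : Prop :=
  forall a : int, a \in A -> (1 <= a) && (a <= N%:Z).

Definition regular_pairs (R : realType) (beta : R) (N : nat) (A : {fset int}) :
    {fset int * int} :=
  [fset w in A `*` A | [&& w.1%:~R <= beta * N%:R,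
                           (1 - beta) * N%:R <= w.2%:~R
                         & gcdz (w.2 - w.1) (primorial beta^-1)%:Z == 1]].

Definition regular (R : realType) (beta kappa : R) (N : nat) (A : {fset int}) :
    Prop :=
  kappa * N%:R ^+ 2 <= #|` regular_pairs beta N A|%:R.

Definition sumset (A1 A2 : {fset int}) : {fset int} :=
  [fset a1 + a2 | a1 in A1, a2 in A2].

Definition nb_repr (A1 A2 : {fset int}) (s : int) : nat :=
  #|` [fset w in A1 `*` A2 | w.1 + w.2 == s]|.

Definition popular_sums (R : realType) (K : R) (A1 A2 : {fset int}) :
    {fset int} :=
  [fset s in sumset A1 A2 | K <= (nb_repr A1 A2 s)%:R].

(* Main.v *)
(* Average over the regular pairs (u, v) to find one for which u + a and v + a
   are both popular for all but beta N elements a of A2, and put m = v - u. All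
   prime factors of m exceed 1/beta, so proper subgroups of Z/m have at most
   beta N elements, and a Pollard-type inequality in Z/m gives about
   min(m, |A1| + |A2|) popular residues. Each popular residue lifts to a popular
   sum, and each good a in A2 gives two popular sums u + a and v + a in the same
   class, which accounts for the additional |A2|. *)
Require Import Defs.
From HB Require Import structures.
From mathcomp Require Import all_boot all_order all_algebra all_fingroup finmap.
From mathcomp Require Import reals zify ring lra.

Set Implicit Arguments.
Unset Strict Implicit.
Unset Printing Implicit Defensive.

Import Order.TTheory GRing.Theory Num.Theory.

Local Open Scope fset_scope.
Local Open Scope ring_scope.

(** * A Pollard-type inequality in a finite abelian group *)

Section Pollard.
Variable G : finZmodType.
Implicit Types A B H : {set G}.

Definition conv A B (x : G) : nat := (\sum_a (a \in A) * ((x - a)%R \in B))%N.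

(** Pollard's sum: it equals the sum over [i] from 1 to [t] of the number of [x] with at least [i]
    representations. *)
Definition trunc_conv t A B : nat := (\sum_x minn t (conv A B x))%N.

Lemma sum_addr (x : G) (F : G -> nat) : (\sum_a F (a + x)%R = \sum_a F a)%N.
Proof. by rewrite [RHS](reindex_inj (addIr x)). Qed.

Lemma sum_subl (x : G) (F : G -> nat) : (\sum_a F (x - a)%R = \sum_a F a)%N.
Proof. by rewrite [RHS](reindex_inj (subrI x)). Qed.

Lemma sum_mem A : (\sum_a (a \in A) = #|A|)%N.
Proof. by rewrite -big_mkcond sum1_card. Qed.

Lemma sum_mem_subl A (x : G) : (\sum_a ((x - a)%R \in A) = #|A|)%N.
Proof. by rewrite (sum_subl x (fun a => nat_of_bool (a \in A))) sum_mem. Qed.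

Lemma sum_conv A B : (\sum_x conv A B x = #|A| * #|B|)%N.
Proof.
rewrite exchange_big /= -sum_mem big_distrl /=.
apply: eq_bigr => a _; rewrite -big_distrr /= -(sum_mem B); congr (_ * _)%N.
exact: (sum_addr (- a) (fun x => nat_of_bool (x \in B))).
Qed.

(** Inclusion-exclusion for [A] and [x - B], whose intersection has [conv A B x] elements. *)
Lemma conv_ge A B x : (#|A| + #|B| <= #|G| + conv A B x)%N.
Proof.
rewrite -(sum_mem A) -(sum_mem_subl B x) -sum1_card -!big_split /=.
by apply: leq_sum => a _; case: (_ \in B); case: (a \in A).
Qed.

(** Split [A] and [B] along [I = A :&: B] and expand bilinearly: the cross terms of [I] with
    [B :\: A] and of [B :\: A] with [I] agree because the group is commutative. *)
Lemma conv_transform A B x :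
  conv A B x = (conv (A :|: B) (A :&: B) x + conv (A :\: B) (B :\: A) x)%N.
Proof.
rewrite /conv.
have sym : (\sum_a (a \in B :\: A) * ((x - a)%R \in A :&: B) =
            \sum_a (a \in A :&: B) * ((x - a)%R \in B :\: A))%N.
  rewrite -[RHS](sum_subl x); apply: eq_bigr => a _.
  by rewrite subKr mulnC.
apply: (@addnI (\sum_a (a \in B :\: A) * ((x - a)%R \in A :&: B))%N).
rewrite [in RHS]sym -!big_split /=; apply: eq_bigr => a _.
by rewrite !inE; case: (a \in A); case: (a \in B); case: ((x - a)%R \in A);
   case: ((x - a)%R \in B).
Qed.

Definition translate B e : {set G} := [set b | b - e \in B].

Lemma trunc_conv_translate t A B e :
  trunc_conv t A (translate B e) = trunc_conv t A B.
Proof.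
rewrite /trunc_conv -(sum_addr (- e) (fun x => minn t (conv A B x))).
apply: eq_bigr => x _; congr minn; apply: eq_bigr => a _.
by rewrite inE addrAC.
Qed.

Lemma card_translate B e : #|translate B e| = #|B|.
Proof.
rewrite -!sum_mem -(sum_addr (- e) (fun x => nat_of_bool (x \in B))).
by apply: eq_bigr => b _; rewrite inE.
Qed.

(* A Pollard-type inequality with the loss D of Kneser's theorem. Dyson's
   transform (A, B) -> (A :|: B, A :&: B), (A :\: B, B :\: A) reduces B, unless
   A is invariant under all differences of B; then B lies in a coset of the
   stabilizer of A. *)
Theorem pollard_subgroup (D t : nat)
    (Dmax : forall H, 0 \in H -> (forall x y, x \in H -> y \in H -> x + y \in H) ->
      H != [set: G] -> (#|H| <= D)%N) A B :
  (t <= #|A|)%N -> (t <= #|B|)%N ->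
  (t * minn #|G| (#|A| + #|B| - (D + t)) <= trunc_conv t A B)%N.
Proof.
have [n] := ubnP #|B|; elim: n t A B => // n IHn t A B ltBn tA tB.
have [->|t_gt0] := posnP t; first by rewrite mul0n.
(* When [|A| + |B| >= |G| + t], every element has at least [t] representations. *)
have [bigAB|smallAB] := leqP (#|G| + t) (#|A| + #|B|).
  apply: leq_trans (leq_mul (leqnn t) (geq_minl _ _)) _.
  rewrite mulnC -sum_nat_const.
  apply: leq_sum => x _; rewrite leq_min leqnn /=.
  by have := conv_ge A B x; lia.
case: (boolP [forall a in A, forall b in B, forall c in B, a - b + c \in A]).
  move=> /forall_inP stab.
  have {}stab a b c : a \in A -> b \in B -> c \in B -> a - b + c \in A.
    by move=> /stab /forall_inP hb /hb /forall_inP; apply.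
  have /card_gt0P [b0 b0B] : (0 < #|B|)%N by lia.
  (* By stability [x + b0 - B] lies inside [A], so [x + b0] has the maximal number of
     representations. *)
  have conv_full x : x \in A -> conv A B (x + b0) = #|B|.
    move=> xA; rewrite -(sum_mem_subl B (x + b0)); apply: eq_bigr => a _.
    have [inB|] := boolP (x + b0 - a \in B); last by rewrite muln0.
    suff -> : a \in A by [].
    have := stab _ _ _ xA inB b0B.
    by rewrite opprB addrCA opprD (addrA x) subrr add0r subrK.
  pose H := [set h | [forall a in A, a + h \in A]].
  have HP h : reflect (forall a, a \in A -> a + h \in A) (h \in H).
    by rewrite inE; apply: forall_inP.
  have geA : (t * #|A| <= trunc_conv t A B)%N.
    rewrite /trunc_conv -(sum_addr b0) mulnC -sum_nat_const [leqLHS]big_mkcond /=.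
    apply: leq_sum => x _; case: ifP => // xA.
    by rewrite conv_full // leq_min leqnn.
  (* It remains that the minimum is at most [|A|]: either the stabilizer [H] is everything and
     [A = G], or [|B| <= |H| <= D]. *)
  apply: leq_trans geA; rewrite leq_mul2l; apply/orP; right.
  have [HT|HT] := eqVneq H [set: G].
    suff -> : A = [set: G] by rewrite cardsT geq_minl.
    have /card_gt0P [a aA] : (0 < #|A|)%N by lia.
    apply/setP => x; rewrite inE; have /HP /(_ _ aA) : x - a \in H by rewrite HT inE.
    by rewrite addrC subrK.
  have cardH : (#|H| <= D)%N.
    apply: Dmax HT; first by apply/HP => a; rewrite addr0.
    move=> x y /HP Hx /HP Hy; apply/HP => a aA.
    by rewrite addrA; apply/Hy/Hx.
  have : (#|B| <= #|H|)%N.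
    rewrite -(card_translate B (- b0)); apply/subset_leq_card/subsetP => b.
    rewrite inE opprK => bB; apply/HP => a aA.
    by have := stab _ _ _ aA b0B bB; rewrite addrA addrAC subrK.
  by rewrite geq_min; lia.
rewrite negb_forall_in => /exists_inP [a aA].
rewrite negb_forall_in => /exists_inP [b bB].
rewrite negb_forall_in => /exists_inP [c cB cA].
(* Translating [B] by [a - b] puts into it both [a], which is in [A], and [a - b + c], which is not;
   so the intersection with [A] is nonempty and smaller than [B]. *)
rewrite -(trunc_conv_translate t A B (a - b)) -(card_translate B (a - b)).
rewrite -(card_translate B (a - b)) in ltBn tB smallAB.
have : a \in translate B (a - b) by rewrite inE subKr.
have : (a - b + c) \in translate B (a - b) by rewrite inE addrC addKr.
move: {bB cB} cA ltBn tB smallAB; move: {b c} (a - b + c) (translate B _) => c {}B.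
move=> cA ltBn tB smallAB cB aB.
have cardU : (#|A :|: B| + #|A :&: B| = #|A| + #|B|)%N by rewrite cardsUI.
have cardA := cardsID B A; have cardB := cardsID A B; rewrite [B :&: A]setIC in cardB.
have ltI : (#|A :&: B| < #|B|)%N.
  apply: proper_card; rewrite properE subsetIr /=.
  by apply: contra cA => /subsetP /(_ _ cB); rewrite inE => /andP[].
have I_gt0 : (0 < #|A :&: B|)%N by apply/card_gt0P; exists a; rewrite inE aA.
have [tI|It] := leqP t #|A :&: B|.
  have := IHn t (A :|: B) (A :&: B) ltac:(lia) ltac:(lia) tI.
  rewrite cardU => /leq_trans; apply; apply: leq_sum => x _.
  by rewrite (conv_transform A B x); lia.
(* Here [A :&: B] has fewer than [t] elements, so the first transformed pair counts in full and only
   the second is truncated, at [t - |A :&: B|]. *)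
have IH := IHn (t - #|A :&: B|)%N (A :\: B) (B :\: A) ltac:(lia) ltac:(lia) ltac:(lia).
have split_sum : (#|A :|: B| * #|A :&: B| + trunc_conv (t - #|A :&: B|) (A :\: B) (B :\: A)
    <= trunc_conv t A B)%N.
  rewrite -sum_conv -big_split /=; apply: leq_sum => x _.
  rewrite (conv_transform A B x).
  have : (conv (A :|: B) (A :&: B) x <= #|A :&: B|)%N.
    rewrite /conv -(sum_mem_subl (A :&: B) x); apply: leq_sum => y _.
    by case: (y \in _); rewrite ?mul1n ?mul0n.
  move: (conv (A :|: B) _ x) (conv (A :\: B) _ x) #|_ :&: _| It; clear=> p q i It p_le.
  lia.
apply: leq_trans split_sum.
move: IH; set S := trunc_conv _ _ _; move: S.
move: #|A :|: B| #|A :&: B| #|A :\: B| #|B :\: A| #|A| #|B| #|G| cardU cardA cardB It smallAB.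
clear=> u i a0 b0 a b g cardU cardA cardB It smallAB S IH.
have [|le_w] := leqP (a + b) (D + t); first by rewrite -subn_eq0 => /eqP ->; rewrite minn0 muln0.
(* [w] is the target excess; since [a0 + b0 = a + b - 2i], induction gives excess [w - i]. If
   [w <= i], the product [u * i] alone suffices. *)
have [w def_w] : exists w, (a + b = D + t + w)%N by exists (a + b - (D + t))%N; lia.
have [s def_t] : exists s, (t = i + s)%N by exists (t - i)%N; lia.
have -> : minn g (a + b - (D + t)) = w by lia.
have [wi|iw] := leqP w i.
  have [j def_i] : exists j, (i = w + j)%N by exists (i - w)%N; lia.
  have -> : u = (w + D + s)%N by lia.
  by rewrite def_t def_i !mulnDl !mulnDr; lia.
have [z def_z] : exists z, (w = i + z)%N by exists (w - i)%N; lia.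
have eq_z : minn g (a0 + b0 - (D + (t - i))) = z by lia.
rewrite eq_z in IH.
have -> : u = (z + D + t)%N by lia.
have eq_s : (t - i)%N = s by lia.
by rewrite eq_s in IH; rewrite def_t def_z !mulnDl !mulnDr; lia.
Qed.
End Pollard.

(** * Subgroups of cyclic groups *)

Lemma Zp_subgroup_card n (H : {set 'I_n.+1}) :
  0 \in H -> (forall x y, x \in H -> y \in H -> x + y \in H) ->
  H != [set: 'I_n.+1] ->
  exists p, [/\ prime p, (p %| n.+1)%N & (#|H| * p <= n.+1)%N].
Proof.
move=> H0 HD HT.
have gH : group_set H by apply/group_setP.
have := cardSg (subsetT (Group gH)); rewrite cardsT card_ord /= => dvdH.
have H_gt0 : (0 < #|H|)%N by apply/card_gt0P; exists 0.
(* [q] is the index of [H], which exceeds 1 because [H] is proper; its least prime factor serves as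
   [p]. *)
have /dvdnP [q eq_n] := dvdH.
have q_gt1 : (1 < q)%N.
  case: q eq_n => [|[|q]] // eq_n; case/negP: HT.
  by rewrite eqEcard subsetT cardsT card_ord -[leqRHS]mul1n -eq_n leqnn.
exists (pdiv q); split; first exact: pdiv_prime.
  by rewrite eq_n dvdn_mulr // pdiv_dvd.
by rewrite [leqRHS]eq_n mulnC leq_mul2r dvdn_leq ?orbT ?pdiv_dvd // ltnW.
Qed.

(** * Counting in finite sets of integers and their residues *)

Lemma size_int_interval (s : seq int) (p : int) (n : nat) :
  uniq s -> (forall x, x \in s -> p <= x < p + n%:Z) -> (size s <= n)%N.
Proof.
move=> us hs; rewrite -[leqRHS](size_iota 0) -(size_map (fun i : nat => p + i%:Z)).
apply: uniq_leq_size => // x /hs hx; apply/mapP; exists `|x - p|%N.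
  by rewrite mem_iota; lia.
by lia.
Qed.

Lemma sum_mem_seq (s : seq int) (P : pred int) :
  (\sum_(x <- s) P x = size (filter P s))%N.
Proof. by rewrite size_filter -sum1_count [RHS]big_mkcond; apply: eq_bigr => x _; case: (P x). Qed.

Lemma card_fset_pairs (A B : {fset int}) (P : pred (int * int)) :
  #|` [fset w in A `*` B | P w]| = (\sum_(a <- A) \sum_(b <- B) P (a, b))%N.
Proof.
rewrite -(big_allpairs (F := fun w => nat_of_bool (P w))) /=.
have -> : (\sum_(w <- [seq (a, b) | a <- A, b <- B]) P w)%N =
          size (filter P [seq (a, b) | a <- A, b <- B]).
  by rewrite size_filter -sum1_count [RHS]big_mkcond; apply: eq_bigr => x _; case: (P x).
apply/perm_size/uniq_perm.
- exact: fset_uniq.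
- by rewrite filter_uniq // allpairs_uniq // => -[? ?] [? ?].
move=> [a b]; rewrite mem_filter !inE /= andbC; congr (_ && _).
by apply/andP/allpairsP => [[aA bB]|[[x y] /= [xA yB [-> ->]]]]; first exists (a, b).
Qed.

Lemma nb_reprE (A B : {fset int}) s :
  nb_repr A B s = (\sum_(a <- A) (s - a \in B)%R)%N.
Proof.
rewrite /nb_repr card_fset_pairs; apply: eq_bigr => a _ /=.
rewrite (eq_bigr (fun b => nat_of_bool (pred1 (s - a) b))).
  by rewrite sum_mem_seq size_filter count_uniq_mem ?fset_uniq.
by move=> b _ /=; rewrite [b == _]eq_sym subr_eq [s == _]eq_sym addrC.
Qed.

(* Residues are taken modulo n.+1; the shift by one turns {0, ..., n} into the
   window {1, ..., n.+1}, so that c corresponds to the sums c.+2 and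
   c + n.+1 + 2. *)
Definition residues n (A : {fset int}) : {set 'I_n.+1} :=
  [set x : 'I_n.+1 | x.+1%:Z \in A].

(** [residues] records the elements of [A] in the window up to [n.+1]; the others lie between [n.+2]
    and [N]. *)
Lemma card_residues N n A : within_1N N A ->
  (#|` A| <= #|residues n A| + (N - n.+1))%N.
Proof.
move=> A_N.
have -> : (#|residues n A| + (N - n.+1))%N =
  size ([seq x.+1%:Z | x : 'I_n.+1 <- enum (residues n A)] ++
        [seq i%:Z | i <- iota n.+2 (N - n.+1)]).
  by rewrite size_cat !size_map size_iota cardE.
apply: uniq_leq_size; first exact: fset_uniq.
move=> a aA; have /andP [a1 aN] := A_N a aA; rewrite mem_cat; apply/orP.
have [le_a|gt_a] := leqP `|a|%N n.+1.
  left; apply/mapP; have lt_a : (`|a|.-1 < n.+1)%N by lia.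
  have eq_a : a = (`|a|.-1).+1%:Z by lia.
  by exists (Ordinal lt_a) => //; rewrite mem_enum inE /= -eq_a.
by right; apply/mapP; exists `|a|%N; [rewrite mem_iota; lia | lia].
Qed.

(** Two window representatives whose residues add up to [c] have integer sum [c.+2] or
    [c + n.+1 + 2], according to whether the residues wrap around. *)
Lemma conv_residues n A B (c : 'I_n.+1) :
  (conv (residues n A) (residues n B) c <=
   nb_repr A B (c.+2%:Z) + nb_repr A B ((c + n.+1)%N.+2%:Z))%N.
Proof.
rewrite !nb_reprE -big_split /=.
pose F (a : int) : nat := ((c.+2%:Z - a \in B)%R + ((c + n.+1)%N.+2%:Z - a \in B)%R)%N.
apply: (@leq_trans (\sum_(a <- [seq x.+1%:Z | x : 'I_n.+1 <- enum (residues n A)]) F a)%N).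
  rewrite big_map big_enum /= [leqRHS]big_mkcond /=; apply: leq_sum => x _.
  case: ifP => // xA; rewrite mul1n inE /F /= modnDmr.
  have [xc|cx] := leqP x c.
    suff -> : ((c + (n.+1 - x)) %% n.+1 = c - x)%N.
      have -> : c.+2%:Z - x.+1%:Z = (c - x)%N.+1%:Z by lia.
      exact: leq_addr.
    by rewrite addnBA 1?ltnW // addnC -addnBA // modnDl modn_small //; have := ltn_ord c; lia.
  rewrite modn_small; last by have := ltn_ord x; lia.
  have -> : (c + n.+1)%N.+2%:Z - x.+1%:Z = (c + (n.+1 - x))%N.+1%:Z.
    by have := ltn_ord x; lia.
  exact: leq_addl.
apply: (@uniq_sub_le_big _ _ leq) => //=.
- by move=> *; rewrite leq_addr.
- by rewrite map_inj_uniq ?enum_uniq // => x y [] /val_inj.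
- exact: fset_uniq.
- by move=> _ /mapP [x + ->]; rewrite mem_enum inE.
Qed.

(* The lifts of C can be chosen outside X + n.+1: if c.+2 + n.+1 is in X + n.+1,
   then c.+2 is in X, hence in D. *)
Lemma card_popular_ge (D X : {fset int}) n (C : {set 'I_n.+1}) :
  (forall s, s \in D -> 2 <= s) ->
  (forall x, x \in X -> (x \in D) && (x + n.+1%:Z \in D)) ->
  (forall c : 'I_n.+1, c \in C -> (c.+2%:Z \in D) || ((c + n.+1)%N.+2%:Z \in D)) ->
  (#|C| + #|` X| <= #|` D|)%N.
Proof.
move=> D_ge2 XD CD.
pose f (c : 'I_n.+1) : int := if c.+2%:Z \in D then c.+2%:Z else (c + n.+1)%N.+2%:Z.
have -> : (#|C| + #|` X|)%N =
    size ([seq f c | c <- enum C] ++ [seq x + n.+1%:Z | x <- X]).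
  by rewrite size_cat !size_map cardE.
apply: uniq_leq_size.
  rewrite cat_uniq !map_inj_uniq ?enum_uniq ?fset_uniq ?andbT /=; last 2 first.
  - exact: addIr.
  - move=> c c'; have := ltn_ord c; have := ltn_ord c'; rewrite /f.
    by do 2 case: ifP => _; move=> ? ? [?]; apply: ord_inj; lia.
  (* The lower lift is at most [n + 2], whereas [x + n.+1] is at least [n + 3] because [x >= 2];
     equality with the upper lift would force [c.+2 = x], which is in [D]. *)
  apply/hasPn => _ /mapP [x xX ->]; apply/mapP => -[c _].
  have /andP [xD _] := XD x xX; have := D_ge2 _ xD; have := ltn_ord c.
  rewrite /f; case: ifPn => [_|cD] ? ? eq_x; first lia.
  by case/negP: cD; rewrite (_ : c.+2%:Z = x) //; lia.
move=> s; rewrite mem_cat => /orP [] /mapP [].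
  by move=> c; rewrite mem_enum => /CD + ->; rewrite /f; case: ifP.
by move=> x /XD /andP [_ xD] ->.
Qed.

(** * Popular sums and averaging *)

Lemma mem_sumset (A1 A2 : {fset int}) a b :
  a \in A1 -> b \in A2 -> a + b \in sumset A1 A2.
Proof. by move=> aA bA; apply/imfset2P; exists a => //; exists b. Qed.

Lemma card_sumset N (A1 A2 : {fset int}) : within_1N N A1 -> within_1N N A2 ->
  (#|` sumset A1 A2| <= 2 * N)%N.
Proof.
move=> A1_N A2_N; apply: (@size_int_interval _ 2); first exact: fset_uniq.
by move=> _ /imfset2P [a /A1_N ? [b /A2_N ? ->]]; lia.
Qed.

(** Grouping the pairs by their sum: an unpopular sum accounts for fewer than [K] of them. *)
Lemma unpopular_pairs_le (R : realType) (K : R) (A1 A2 : {fset int}) : 0 <= K ->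
  (\sum_(u <- A1) \sum_(a <- A2) (u + a \notin popular_sums K A1 A2)%R)%N%:R
    <= K * #|` sumset A1 A2|%:R.
Proof.
move=> K_ge0; set P := popular_sums K A1 A2.
have le_repr : (\sum_(u <- A1) \sum_(a <- A2) (u + a \notin P)%R <=
    \sum_(s <- sumset A1 A2) (s \notin P) * nb_repr A1 A2 s)%N.
  have -> : (\sum_(s <- sumset A1 A2) (s \notin P) * nb_repr A1 A2 s)%N =
      (\sum_(u <- A1) \sum_(s <- sumset A1 A2) (s \notin P) * (s - u \in A2)%R)%N.
    rewrite exchange_big; apply: eq_bigr => s _.
    by rewrite nb_reprE big_distrr.
  rewrite big_seq [leqRHS]big_seq; apply: leq_sum => u uA1.
  have -> : (\sum_(a <- A2) (u + a \notin P)%R =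
      \sum_(s <- [seq (u + a)%R | a <- A2]) (s \notin P) * (s - u \in A2)%R)%N.
    rewrite big_map big_seq [RHS]big_seq; apply: eq_bigr => a aA2.
    by rewrite addrAC subrr add0r aA2 muln1.
  apply: (@uniq_sub_le_big _ _ leq) => //=.
  - by move=> *; rewrite leq_addr.
  - by rewrite map_inj_uniq ?fset_uniq //; apply: addrI.
  - exact: fset_uniq.
  - by move=> _ /mapP [a aA2 ->]; apply: mem_sumset.
apply: (le_trans (y := (\sum_(s <- sumset A1 A2) (s \notin P) * nb_repr A1 A2 s)%N%:R)).
  by rewrite ler_nat.
have -> : #|` sumset A1 A2| = (\sum_(s <- sumset A1 A2) 1)%N.
  by rewrite sum1_size.
rewrite !natr_sum mulr_sumr big_seq [leRHS]big_seq; apply: ler_sum => s sS.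
rewrite mulr1; case: (boolP (s \in P)) => [_|]; first by rewrite mul0n.
by rewrite mul1n /P !inE sS /= -ltNge => /ltW.
Qed.

(** Summing [b u + b v] over the edges of [E] counts each weight once per incident edge, hence at
    most [k + l] times; if all edges exceeded [T], the total would be too large. *)
Lemma averaging (R : realType) (A : seq int) (E : int -> int -> bool)
    (b : int -> nat) (k l : nat) (T : R) :
  (forall u, u \in A -> \sum_(v <- A) E u v <= l)%N ->
  (forall v, v \in A -> \sum_(u <- A) E u v <= k)%N ->
  ((k + l) * \sum_(u <- A) b u)%N%:R < T * (\sum_(u <- A) \sum_(v <- A) E u v)%N%:R ->
  exists u v, [/\ u \in A, v \in A, E u v & (b u + b v)%:R <= T].
Proof.
move=> degl degk ltT.
have [/hasP [u uA /hasP [v vA /andP [Euv le_T]]]|noE] :=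
  boolP (has (fun u => has (fun v => E u v && ((b u + b v)%:R <= T)) A) A).
  by exists u, v.
have bigE u v : u \in A -> v \in A -> E u v -> T < (b u + b v)%:R.
  move=> uA vA Euv; rewrite ltNge; apply: contra noE => le_T.
  by apply/hasP; exists u => //; apply/hasP; exists v => //; rewrite Euv.
have leE : T * (\sum_(u <- A) \sum_(v <- A) E u v)%N%:R <=
    (\sum_(u <- A) \sum_(v <- A) E u v * (b u + b v))%N%:R.
  rewrite !natr_sum mulr_sumr big_seq [leRHS]big_seq; apply: ler_sum => u uA.
  rewrite !natr_sum mulr_sumr big_seq [leRHS]big_seq; apply: ler_sum => v vA.
  have := bigE u v uA vA; case: (E u v) => [/(_ isT) /ltW|_].
    by rewrite mulr1 mul1n.
  by rewrite mulr0 mul0n.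
have le_deg : (\sum_(u <- A) \sum_(v <- A) E u v * (b u + b v) <=
    (k + l) * \sum_(u <- A) b u)%N.
  have -> : (\sum_(u <- A) \sum_(v <- A) E u v * (b u + b v) =
     \sum_(u <- A) b u * \sum_(v <- A) E u v +
     \sum_(v <- A) b v * \sum_(u <- A) E u v)%N.
    under [X in (_ + X)%N]eq_bigr do rewrite big_distrr /=.
    rewrite [X in (_ + X)%N]exchange_big -big_split /=; apply: eq_bigr => u _.
    rewrite big_distrr -big_split /=; apply: eq_bigr => v _.
    by rewrite mulnDr !(mulnC (E u v)).
  rewrite addnC mulnDl !big_distrr /=; apply: leq_add.
    rewrite big_seq [leqRHS]big_seq; apply: leq_sum => v vA.
    by rewrite mulnC leq_mul2r degk ?orbT.
  rewrite big_seq [leqRHS]big_seq; apply: leq_sum => u uA.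
  by rewrite mulnC leq_mul2r degl ?orbT.
have := lt_le_trans ltT leE; rewrite ltr_nat ltnNge.
by rewrite le_deg.
Qed.

Lemma prime_gt_of_coprime_primorial (R : realType) (y : R) (d : int) p :
  0 <= y -> gcdz d (primorial y)%:Z = 1 -> prime p -> (p %| `|d|)%N -> y < p%:R.
Proof.
move=> y_ge0 gcd1 p_pr p_d; rewrite ltNge; apply/negP => p_le.
have p_dvd : (p %| primorial y)%N.
  have p_in : (p < (Num.truncn y).+1)%N by rewrite ltnS truncn_ge_nat.
  rewrite /primorial big_mkcond (bigD1_seq p) ?iota_uniq ?mem_index_iota //=.
  by rewrite p_pr p_le dvdn_mulr.
have : (p %| gcdn `|d| (primorial y))%N by rewrite dvdn_gcd p_d.
by move: gcd1 => [->]; rewrite dvdn1 => /eqP p1; rewrite p1 in p_pr.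
Qed.

(** Pigeonhole over the two lifts of [c]; [K > 0] makes the popular lift an actual sum. *)
Lemma conv_popular (R : realType) (K : R) n (A B : {fset int}) (c : 'I_n.+1) :
  0 < K -> 2 * K <= (conv (residues n A) (residues n B) c)%:R ->
  (c.+2%:Z \in popular_sums K A B) || ((c + n.+1)%N.+2%:Z \in popular_sums K A B).
Proof.
move=> K_gt0 le_K.
have pop s : K <= (nb_repr A B s)%:R -> s \in popular_sums K A B.
  move=> le_s; rewrite !inE /= le_s andbT.
  have : (0 < nb_repr A B s)%N by rewrite -(ltr_nat R) (lt_le_trans K_gt0).
  rewrite /nb_repr cardfs_gt0 => /fset0Pn [[a b]]; rewrite !inE /=.
  by move=> /andP [/andP [aA bB] /eqP <-]; apply: mem_sumset.
have := conv_residues A B c; rewrite -(ler_nat R) natrD => /(le_trans le_K) le2K.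
have [le1|lt1] := lerP K (nb_repr A B c.+2%:Z)%:R; first by rewrite pop.
by apply/orP; right; apply: pop; lra.
Qed.

Lemma trunc_conv_le_popular (R : realType) (K : R) (G : finZmodType) t (A B : {set G}) :
  0 <= K ->
  (trunc_conv t A B)%:R <=
    t%:R * #|[set x | K <= (conv A B x)%:R]|%:R + K * #|G|%:R.
Proof.
move=> K_ge0; rewrite -!sum1_card !natr_sum !mulr_sumr [X in _ <= X + _]big_mkcond.
rewrite -big_split /=; apply: ler_sum => x _; rewrite inE !mulr1.
case: ifPn => [_|]; last rewrite -ltNge => /ltW le_K.
  by rewrite -[leLHS]addr0 lerD // ler_nat geq_minl.
by rewrite add0r (le_trans _ le_K) // ler_nat geq_minr.
Qed.

Lemma popular_sums_ge2 (R : realType) (K : R) N (A1 A2 : {fset int}) s :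
  within_1N N A1 -> within_1N N A2 -> s \in popular_sums K A1 A2 -> 2 <= s.
Proof.
move=> A1_N A2_N; rewrite !inE /= => /andP [/imfset2P [a /A1_N ? [b /A2_N ? ->]] _].
by lia.
Qed.

Lemma sum_int_interval (A : {fset int}) (P : pred int) (p : int) (n : nat) :
  (forall x, x \in A -> P x -> p <= x < p + n%:Z) -> (\sum_(x <- A) P x <= n)%N.
Proof.
move=> P_p; rewrite sum_mem_seq; apply: (@size_int_interval _ p).
  by rewrite filter_uniq ?fset_uniq.
by move=> x; rewrite mem_filter => /andP [Px /P_p]; apply.
Qed.

(** * Regular pairs *)

Section RegularPairs.
Variables (R : realType) (beta : R) (N : nat) (A : {fset int}).
Hypotheses (beta_gt0 : 0 < beta) (A_N : within_1N N A).

Definition regular_pair (u v : int) : bool :=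
  [&& u%:~R <= beta * N%:R, (1 - beta) * N%:R <= v%:~R
    & gcdz (v - u) (primorial beta^-1)%:Z == 1].

Let k := Num.truncn (beta * N%:R).

Lemma card_regular_pairs :
  #|` regular_pairs beta N A| = (\sum_(u <- A) \sum_(v <- A) regular_pair u v)%N.
Proof. exact: card_fset_pairs. Qed.

Lemma regular_pair_ends u v : u \in A -> v \in A -> regular_pair u v ->
  u <= k%:Z /\ N%:Z - k%:Z <= v.
Proof.
move=> /A_N uN /A_N vN /and3P [u_le v_ge _]; split.
  have [i eq_u] : exists i : nat, u = i%:Z by exists `|u|%N; lia.
  by move: u_le; rewrite eq_u lez_nat truncn_ge_nat // mulr_ge0 // ltW.
have [i eq_v] : exists i : nat, N%:Z - v = i%:Z by exists `|N%:Z - v|%N; lia.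
suff : (i <= k)%N by lia.
have -> : (i <= k)%N = (i%:Z%:~R <= beta * N%:R).
  by rewrite /k truncn_ge_nat // mulr_ge0 // ltW.
by rewrite -eq_v rmorphB /= -[N%:Z%:~R]/(N%:R : R); lra.
Qed.

(** [v] runs through [N - k, ..., N], which is [k + 1] integers, whereas in [regular_pair_in] [u]
    runs through [1, ..., k]. *)
Lemma regular_pair_out u : u \in A -> (\sum_(v <- A) regular_pair u v <= k.+1)%N.
Proof.
move=> uA; apply: (@sum_int_interval _ _ (N%:Z - k%:Z)) => v vA /(regular_pair_ends uA vA).
by have := A_N vA; lia.
Qed.

Lemma regular_pair_in v : v \in A -> (\sum_(u <- A) regular_pair u v <= k)%N.
Proof.
move=> vA; apply: (@sum_int_interval _ (regular_pair^~ v) 1) => u uA /(regular_pair_ends uA vA).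
by have := A_N uA; lia.
Qed.

Lemma card_regular_pairs_le : (#|` regular_pairs beta N A| <= k * k.+1)%N.
Proof.
rewrite card_regular_pairs.
apply: (@leq_trans (\sum_(u <- A) (u <= k%:Z)%R * k.+1)%N).
  rewrite big_seq [leqRHS]big_seq; apply: leq_sum => u uA.
  have [u_le|u_gt] := boolP (u <= k%:Z); first by rewrite mul1n regular_pair_out.
  rewrite big_seq big1 // => v vA; apply/eqP; rewrite eqb0.
  by apply: contra u_gt => /(regular_pair_ends uA vA) [].
rewrite -big_distrl leq_mul2r /=; apply: (@sum_int_interval _ _ 1) => u uA.
by have := A_N uA; lia.
Qed.

End RegularPairs.

(** * The modulus and the good pair *)

Lemma subgroup_card_le (R : realType) (beta : R) (N n : nat) (H : {set 'I_n.+1}) :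
  0 < beta -> (n < N)%N -> gcdz n.+1%:Z (primorial beta^-1)%:Z = 1 ->
  0 \in H -> (forall x y, x \in H -> y \in H -> x + y \in H) ->
  H != [set: 'I_n.+1] -> (#|H| <= Num.truncn (beta * N%:R))%N.
Proof.
move=> beta_gt0 ltnN gcd1 H0 HD HT.
(* The index has a prime factor [p > 1 / beta], so [|H| <= N / p <= beta * N]. *)
have [p [p_pr p_n le_n]] := Zp_subgroup_card H0 HD HT.
have beta_inv : 0 <= beta^-1 by rewrite invr_ge0 ltW.
have p_gt := prime_gt_of_coprime_primorial beta_inv gcd1 p_pr p_n.
rewrite truncn_ge_nat ?mulr_ge0 ?(ltW beta_gt0) //.
have p_beta : 1 <= p%:R * beta by rewrite -ler_pdivrMr // mul1r ltW.
have le_N : #|H|%:R * p%:R <= N%:R :> R by rewrite -natrM ler_nat (leq_trans le_n).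
have H_ge0 : 0 <= #|H|%:R :> R by [].
by nra.
Qed.

Lemma good_pair (R : realType) (beta kappa : R) (N : nat) (A1 A2 : {fset int})
    (gamma : R) :
  0 < beta -> 0 < kappa -> (0 < N)%N -> within_1N N A1 -> within_1N N A2 ->
  regular beta kappa N A1 -> 0 < gamma -> gamma < kappa ^+ 2 / (16 * beta ^+ 2) ->
  let P := popular_sums (gamma * N%:R) A1 A2 in
  (0 < Num.truncn (beta * N%:R))%N /\
  exists u v, [/\ u \in A1, v \in A1, regular_pair beta N u v &
    (\sum_(a <- A2) (u + a \notin P)%R + \sum_(a <- A2) (v + a \notin P)%R)%N%:R
      <= beta * N%:R].
Proof.
move=> beta_gt0 kappa_gt0 N_gt0 A1_N A2_N reg gamma_gt0 gamma_lt P.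
set k := Num.truncn _.
have N_gt0R : 0 < N%:R :> R by rewrite ltr0n.
have bN_ge0 : 0 <= beta * N%:R by rewrite mulr_ge0 // ltW.
have k_le : k%:R <= beta * N%:R by rewrite truncn_le.
have cardG := card_regular_pairs_le beta_gt0 A1_N.
rewrite -/k -(ler_nat R) in cardG.
have kN2 : 0 < kappa * N%:R ^+ 2 by rewrite mulr_gt0 // exprn_gt0.
have k_gt0 : (0 < k)%N.
  case: (k) cardG => // cardG.
  by have := lt_le_trans kN2 (le_trans reg cardG); rewrite mul0n ltxx.
split=> //.
have k_ge1 : 1 <= k%:R :> R by rewrite ler1n.
(* There are at most [k * k.+1 <= 2 * k ^ 2] regular pairs. *)
have kappa_le : kappa <= 2 * beta ^+ 2.
  have h : kappa * N%:R ^+ 2 <= 2 * beta ^+ 2 * N%:R ^+ 2.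
    apply: le_trans reg (le_trans cardG _).
    rewrite natrM -natr1 -mulrA -exprMn; nra.
  by rewrite ler_pM2r ?exprn_gt0 // in h.
(* [kappa <= 2 * beta ^ 2] gives [kappa ^ 2 / (16 * beta ^ 2) <= kappa / 8]. *)
have gamma_kappa : 8 * gamma < kappa.
  rewrite ltr_pdivlMr ?mulr_gt0 ?exprn_gt0 // in gamma_lt.
  have : gamma * (16 * beta ^+ 2) < kappa * (2 * beta ^+ 2) by nra.
  have b2 : 0 < 2 * beta ^+ 2 by rewrite mulr_gt0 ?exprn_gt0.
  rewrite (_ : gamma * _ = 8 * gamma * (2 * beta ^+ 2)); last by ring.
  by rewrite ltr_pM2r.
apply: (@averaging _ _ _ (fun u => \sum_(a <- A2) (u + a \notin P)%R)%N k k.+1).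
- by move=> u; apply: regular_pair_out.
- by move=> v; apply: regular_pair_in.
rewrite -card_regular_pairs.
have le_bad : (\sum_(u <- A1) \sum_(a <- A2) (u + a \notin P)%R)%N%:R
    <= gamma * N%:R * (2 * N%:R).
  have K_ge0 : 0 <= gamma * N%:R by rewrite mulr_ge0 // ltW.
  apply: le_trans (unpopular_pairs_le A1 A2 K_ge0) _.
  by rewrite ler_wpM2l // -natrM ler_nat card_sumset.
apply: lt_le_trans (ler_wpM2l bN_ge0 reg).
rewrite natrM; set B := _%:R in le_bad *.
have B_ge0 : 0 <= B by [].
(* From [k >= 1]; the weighted total is then at most [6 * gamma * beta * N ^ 3], below
   [kappa * beta * N ^ 3]. *)
have le_3k : (k + k.+1)%:R <= 3 * (beta * N%:R) :> R.
  by rewrite natrD -natr1; lra.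
apply: le_lt_trans (ler_pM _ B_ge0 le_3k le_bad) _ => //.
have -> : 3 * (beta * N%:R) * (gamma * N%:R * (2 * N%:R)) =
    6 * gamma * (beta * N%:R * N%:R ^+ 2) by ring.
have -> : beta * N%:R * (kappa * N%:R ^+ 2) = kappa * (beta * N%:R * N%:R ^+ 2) by ring.
by rewrite ltr_pM2r ?mulr_gt0 ?exprn_gt0 //; lra.
Qed.

(** * Assembling the bound modulo [v - u] *)

Theorem theorem2p4 (R : realType) (beta kappa : R) (N : nat)
    (A1 A2 : {fset int})
    (beta_gt0 : 0 < beta) (beta_lt : beta < 1 / 6)
    (kappa_gt0 : 0 < kappa) (kappa_lt1 : kappa < 1)
    (N_gt0 : (0 < N)%N)
    (A1_sub : within_1N N A1) (A2_sub : within_1N N A2)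
    (A1_card : 4 * beta * N%:R <= #|` A1|%:R)
    (A2_card : 4 * beta * N%:R <= #|` A2|%:R)
    (A1_regular : regular beta kappa N A1)
    (gamma : R) (gamma_gt0 : 0 < gamma)
    (gamma_lt : gamma < Num.min (kappa ^+ 2 / (16 * beta ^+ 2))
                                (beta ^+ 2 / 16)) :
  Num.min N%:R (#|` A1|%:R + #|` A2|%:R) + #|` A2|%:R - 9 * beta * N%:R
    <= #|` popular_sums (gamma * N%:R) A1 A2|%:R :> R.
Proof.
move: gamma_lt; rewrite lt_min => /andP [gamma_kappa gamma_beta].
have [] := good_pair beta_gt0 kappa_gt0 N_gt0 A1_sub A2_sub A1_regular gamma_gt0 gamma_kappa.
set P := popular_sums _ _ _; set k := Num.truncn _ => k_gt0 [u [v [uA vA Euv le_bad]]].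
have N_gt0R : 0 < N%:R :> R by rewrite ltr0n.
have bN_ge0 : 0 <= beta * N%:R by rewrite mulr_ge0 // ltW.
have k_le : k%:R <= beta * N%:R by rewrite truncn_le.
have k_ge1 : 1 <= k%:R :> R by rewrite ler1n.
have k_gt : beta * N%:R <= 2 * k%:R.
  have : beta * N%:R < k.+1%:R by rewrite truncnS_gt.
  by rewrite -natr1; lra.
have lt_6k : (6 * k < N)%N by rewrite -(ltr_nat R) natrM; nra.
have [u_le v_ge] := regular_pair_ends beta_gt0 A1_sub uA vA Euv.
rewrite -/k in u_le v_ge.
have := A1_sub _ uA; have := A1_sub _ vA => vN uN.
(* The modulus [v - u] is [n.+1]; it is positive as [u <= k], [v >= N - k] and [6 * k < N]. *)
have [n eq_n] : exists n, v - u = n.+1%:Z.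
  by exists (`|v - u|.-1)%N; move: u_le v_ge lt_6k; clear; lia.
have ltnN : (n < N)%N by move: eq_n vN uN; clear; lia.
have le_N : (N <= n.+1 + 2 * k)%N by move: eq_n u_le v_ge; clear; lia.
have gcd1 : gcdz n.+1%:Z (primorial beta^-1)%:Z = 1.
  by case/and3P: Euv => _ _; rewrite eq_n => /eqP.
have card1 := card_residues n A1_sub; have card2 := card_residues n A2_sub.
have A1_4k : (4 * k <= #|` A1|)%N by rewrite -(ler_nat R) natrM; lra.
have A2_4k : (4 * k <= #|` A2|)%N by rewrite -(ler_nat R) natrM; lra.
have k_res1 : (k <= #|residues n A1|)%N by move: card1 A1_4k le_N; clear; lia.
have k_res2 : (k <= #|residues n A2|)%N by move: card2 A2_4k le_N; clear; lia.
(* Both the loss and the truncation level are [k]; the residue sets reach it because each set has at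
   least [4 * k] elements and loses at most [2 * k]. *)
have := @pollard_subgroup _ k k (fun H => @subgroup_card_le R beta N n H beta_gt0 ltnN gcd1)
  _ _ k_res1 k_res2.
have K_gt0 : 0 < gamma * N%:R by rewrite mulr_gt0.
(* The threshold is doubled because a residue has two lifts. *)
have K2_ge0 : 0 <= 2 * (gamma * N%:R) by lra.
have := trunc_conv_le_popular k (residues n A1) (residues n A2) K2_ge0.
rewrite card_ord; set C := [set x | _] => le_S.
rewrite -(ler_nat R) => /le_trans /(_ le_S) {le_S}.
(* Residues below the threshold cost little, since [gamma < beta ^ 2 / 16], [n.+1 <= N] and
   [beta * N <= 2 * k]. *)
have le_err : 2 * (gamma * N%:R) * n.+1%:R <= k%:R * (beta * N%:R / 4).
  have le_n : n.+1%:R <= N%:R :> R by rewrite ler_nat.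
  have h1 : 2 * (gamma * N%:R) * n.+1%:R <= 2 * (beta ^+ 2 / 16 * N%:R) * N%:R.
    apply: ler_pM => //; nra.
  apply: le_trans h1 _; nra.
rewrite natrM => le_k.
have {le_k le_err} le_C : (minn n.+1 (#|residues n A1| + #|residues n A2| - (k + k)))%:R
    <= #|C|%:R + beta * N%:R / 4.
  rewrite -(ler_pM2l (_ : 0 < k%:R)) ?ltr0n // mulrDr.
  by apply: le_trans le_k _; rewrite lerD2l.
pose good a := (u + a \in P) && (v + a \in P).
pose X := [fset x in [seq u + a | a <- A2 & good a]].
have cardX : (#|` A2| <= #|` X| + (\sum_(a <- A2) (u + a \notin P)%R
    + \sum_(a <- A2) (v + a \notin P)%R))%N.
  rewrite card_fseq undup_id; last by rewrite map_inj_uniq ?filter_uniq ?fset_uniq //; apply: addrI.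
  rewrite size_map -sum_mem_seq -!big_split -[leqLHS]sum1_size /=.
  by apply: leq_sum => a _; rewrite /good; case: (_ \in P); case: (_ \in P).
have card_P : (#|C| + #|` X| <= #|` P|)%N.
  apply: card_popular_ge.
  - by move=> s; apply: popular_sums_ge2 A1_sub A2_sub.
  - move=> x; rewrite in_fset => /mapP [a]; rewrite mem_filter => /andP [/andP [uP vP] _] ->.
    by rewrite uP -eq_n addrAC subrKC.
  - by move=> c; rewrite inE; apply: conv_popular.
have card_PR : #|C|%:R + #|` X|%:R <= #|` P|%:R :> R by rewrite -natrD ler_nat.
have card_XR : #|` A2|%:R <= #|` X|%:R + beta * N%:R.
  by apply: le_trans (lerD (lexx _) le_bad); rewrite -natrD ler_nat.
(* [6 * k] covers the [2 * k] lost by each residue set and the [k + k] of the Pollard bound; the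
   modulus itself is at least [N - 2 * k]. *)
have le_min : Num.min N%:R (#|` A1|%:R + #|` A2|%:R) <=
    (minn n.+1 (#|residues n A1| + #|residues n A2| - (k + k)))%:R + 6 * k%:R :> R.
  rewrite -natrD -natr_min -natrM -natrD ler_nat; move: card1 card2 le_N; clear; lia.
(* The losses are [6 * k <= 6 * beta * N], then [beta * N / 4] from unpopular residues and
   [beta * N] from bad elements of [A2], in all below [9 * beta * N]. *)
lra.
Qed.
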